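(* There exists an integer $N$ such that for every field $\mathbb{F}$ with $|\mathbb{F}|\ge N$, every integer $q\ge 7$ and every integer $k\ge 3$, we have the strict inequality $\mathrm{R}\bigl((\mathrm{Str}_q^k)^{\otimes 2}\bigr)<\mathrm{R}(\mathrm{Str}_q^k)^2$.
   Context: Let $b_1,\dots,b_{q+1}$ be the standard basis of $\mathbb{F}^{q+1}$. For $k\ge 3$ and $q\ge 1$, $\mathrm{Str}_q^k=\sum_{i=2}^{q+1}\bigl(b_i\otimes b_i\otimes b_1\otimes b_1^{\otimes (k-3)}+b_1\otimes b_i\otimes b_i\otimes b_1^{\otimes (k-3)}\bigr)\in(\mathbb{F}^{q+1})^{\otimes k}$. The tensor rank $\mathrm{R}(t)$ of a $k$-tensor $t\in U_1\otimes\cdots\otimes U_k$ over $\mathbb{F}$ is the smallest $r$ such that $t$ is a sum of $r$ simple tensors $u_1\otimes\cdots\otimes u_k$. The tensor square $(\mathrm{Str}_q^k)^{\otimes 2}$ is regarded as a $2k$-tensor in $(\mathbb{F}^{q+1})^{\otimes 2k}$ (no factors are grouped). *)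

(* Defs.v *)
From mathcomp Require Import all_boot all_order all_algebra.
From mathcomp Require Import boolp classical_sets.

Set Implicit Arguments.
Unset Strict Implicit.
Unset Printing Implicit Defensive.

Import GRing.Theory.
Local Open Scope ring_scope.

(* (F^d)^{\otimes k}, in coordinates: the entry of t at the multi-index
   (i_0, ..., i_(k-1)) is the coefficient of b_(i_0) \otimes ... \otimes b_(i_(k-1)). *)
Notation tensor F d k := {ffun {ffun 'I_k -> 'I_d} -> F}.

Definition simple_tensor (F : fieldType) (d k : nat) (u : 'I_k -> 'rV[F]_d) :
    tensor F d k :=
  [ffun i : {ffun 'I_k -> 'I_d} => \prod_(j < k) u j 0 (i j)].

Definition tensor_mul (F : fieldType) (d k l : nat)
    (s : tensor F d k) (t : tensor F d l) : tensor F d (k + l) :=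
  [ffun i : {ffun 'I_(k + l) -> 'I_d} =>
     s [ffun j => i (lshift l j)] * t [ffun j => i (rshift k j)]].

Definition sum_of_simple (F : fieldType) (d k : nat) (t : tensor F d k)
    (r : nat) : Prop :=
  exists u : 'I_r -> 'I_k -> 'rV[F]_d,
    t = \sum_(a < r) simple_tensor (u a).

(* The default value 0 of xget is relevant only for k = 0, where the only simple
   tensor is the empty product 1; see tensor_rankP. *)
Definition tensor_rank (F : fieldType) (d k : nat) (t : tensor F d k) : nat :=
  xget 0%N [set r : nat | sum_of_simple t r /\
                          forall s : nat, sum_of_simple t s -> (r <= s)%N]%classic.

Lemma sum_of_simple_ex (F : fieldType) (d k : nat) (t : tensor F d k) :
  (0 < k)%N -> exists r, sum_of_simple t r.
Proof.
case: k t => // k t _.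
pose I := {ffun 'I_k.+1 -> 'I_d}.
exists #|{: I}|.
exists (fun a j => (if j == ord0 then t (enum_val a) else 1) *:
                     delta_mx 0 ((enum_val a : I) j)).
apply/ffunP => i; rewrite sum_ffunE (reindex_onto enum_rank enum_val) /=; last first.
  by move=> a _; rewrite enum_valK.
rewrite (bigD1 i) /=; last by rewrite enum_rankK eqxx.
rewrite big1 ?addr0 => [|i' /andP[_ nei]].
  rewrite ffunE enum_rankK big_ord_recl big1 => [|j _].
    by rewrite !mxE !eqxx !mulr1.
  by rewrite !mxE !eqxx mulr1.
have [j nej] : exists j, i' j != i j.
  by apply/existsP; apply: contraR nei => /existsPn h; apply/eqP/ffunP => j;
    apply/eqP; move: (h j); rewrite negbK.
rewrite ffunE enum_rankK (bigD1 j) //= !mxE eqxx /= [i j == _]eq_sym.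
by rewrite (negPf nej) mulr0 mul0r.
Qed.

Lemma tensor_rankP (F : fieldType) (d k : nat) (t : tensor F d k) :
  (0 < k)%N ->
  sum_of_simple t (tensor_rank t) /\
  forall s : nat, sum_of_simple t s -> (tensor_rank t <= s)%N.
Proof.
move=> k_gt0; rewrite /tensor_rank; case: xgetP => [r -> //|no_min].
have ex : exists r, `[< sum_of_simple t r >].
  by have [r tr] := sum_of_simple_ex t k_gt0; exists r; apply/asboolP.
case: (ex_minnP ex) => r /asboolP tr r_min; case: (no_min r); split=> // s ts.
by apply: r_min; apply/asboolP.
Qed.

(* Indices are 0-based: b_1 is basis_vec ord0, and b_2, ..., b_(q+1) are the
   basis_vec (lift ord0 i) for i < q. *)
Definition basis_vec (F : fieldType) (d : nat) (i : 'I_d) : 'rV[F]_d :=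
  delta_mx 0 i.

(* The first summand has b_i in the first two factors, the second one in the
   second and third factors; all other factors are b_1. Meant for 3 <= k. *)
Definition Str (F : fieldType) (q k : nat) : tensor F q.+1 k :=
  \sum_(i < q)
    (simple_tensor (fun j : 'I_k =>
       basis_vec F (if (j < 2)%N then lift ord0 i else ord0)) +
     simple_tensor (fun j : 'I_k =>
       basis_vec F (if (0 < j < 3)%N then lift ord0 i else ord0))).

(* Main.v *)
Require Import Defs.
From mathcomp Require Import all_boot all_order all_algebra.
From mathcomp Require Import ring zify.

(** The tensor Str has a border rank about half its rank, and this gap survives
    in the square.

    Lower bound: Str has rank at least 2 q ([Str_rank_ge]).  Take a
    decomposition of Str, contract the factors after the third with the
    functional dual to b_1, and the third factor with a functional phi such
    that phi(b_1) <> 0.  What remains is a matrix of rank at least q, because it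
    contains the block phi(b_1) times the identity.  The third vectors of the
    decomposition span F^(q+1), so phi can be chosen to kill q of them; then the
    matrix is a sum of r - q matrices of rank at most one, and q <= r - q.

    Upper bound: the square of Str has rank at most 3 (q+1)^2 ([Str_sq_rank_le]).
    For e <> 0 the tensor Str + e T, with T the sum of the
    b_i (x) b_i (x) b_i (x) b_1 ... b_1, has rank at most q + 1, by the identity
      e (Str + e T) = sum_i (b_1 + e b_i) (x) b_i (x) (b_1 + e b_i) (x) b_1 ... b_1
                      - b_1 (x) (sum_i b_i) (x) b_1 (x) b_1 ... b_1.
    The square of Str + e T is a polynomial of degree 2 in e whose constant term
    is the square of Str, so Lagrange interpolation at three distinct nonzero
    values of e writes the latter as a combination of three tensors of rank at
    most (q+1)^2.

    Finally 3 (q+1)^2 < (2 q)^2 as soon as q >= 7, and a field with four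
    elements has three nonzero ones. *)

Set Implicit Arguments.
Unset Strict Implicit.
Unset Printing Implicit Defensive.

Import GRing.Theory.
Local Open Scope ring_scope.

(** * Upper bounds on the number of simple summands *)

Section SumOfSimple.
Variables (F : fieldType) (d : nat).

Lemma sum_of_simple_fin k (I : finType) (u : I -> 'I_k -> 'rV[F]_d) :
  sum_of_simple (\sum_i simple_tensor (u i)) #|I|.
Proof.
exists (fun a => u (enum_val a)).
by rewrite (reindex (@enum_val I predT)) //; apply/onW_bij/enum_val_bij.
Qed.

Lemma sum_of_simpleD k (s t : tensor F d k) m n :
  sum_of_simple s m -> sum_of_simple t n -> sum_of_simple (s + t) (m + n).
Proof.
move=> [u ->] [v ->].
exists (fun a => match split a with inl b => u b | inr c => v c end).
rewrite big_split_ord; congr (_ + _); apply: eq_bigr => a _ /=.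
  by rewrite (unsplitK (inl a)).
by rewrite (unsplitK (inr a)).
Qed.

Definition tensor_scale k (c : F) (t : tensor F d k) : tensor F d k :=
  [ffun i => c * t i].

Lemma sum_of_simpleZ k c (t : tensor F d k.+1) n :
  sum_of_simple t n -> sum_of_simple (tensor_scale c t) n.
Proof.
move=> [u ->].
exists (fun a j => (if j == ord0 then c else 1) *: u a j).
apply/ffunP => i; rewrite ffunE !sum_ffunE mulr_sumr; apply: eq_bigr => a _.
rewrite !ffunE !big_ord_recl eqxx !mxE mulrA; congr (_ * _).
by apply: eq_bigr => j _; rewrite mxE mul1r.
Qed.

Lemma sum_of_simple_mul k l (s : tensor F d k) (t : tensor F d l) m n :
  sum_of_simple s m -> sum_of_simple t n ->
  sum_of_simple (tensor_mul s t) (m * n).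
Proof.
move=> [u ->] [v ->].
pose w (p : 'I_m * 'I_n) (j : 'I_(k + l)) :=
  match split j with inl j1 => u p.1 j1 | inr j2 => v p.2 j2 end.
suff -> : tensor_mul (\sum_a simple_tensor (u a)) (\sum_b simple_tensor (v b))
        = \sum_p simple_tensor (w p).
  by have := sum_of_simple_fin w; rewrite card_prod !card_ord.
apply/ffunP => i; rewrite ffunE !sum_ffunE big_distrlr /=.
rewrite pair_big; apply: eq_bigr => -[a b] _; rewrite !ffunE big_split_ord /=.
congr (_ * _); apply: eq_bigr => j _; rewrite /w !ffunE.
  by rewrite (unsplitK (inl j)).
by rewrite (unsplitK (inr j)).
Qed.

(** Quadratic Lagrange interpolation at 0 of the polynomial (s + e t)^2 in e. *)
Lemma tensor_sq_interpolation k (s t : tensor F d k) (e0 e1 e2 : F) :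
  uniq [:: e0; e1; e2] ->
  let sq e := tensor_mul (s + tensor_scale e t) (s + tensor_scale e t) in
  tensor_mul s s =
      tensor_scale (e1 * e2 / ((e1 - e0) * (e2 - e0))) (sq e0)
    + tensor_scale (e0 * e2 / ((e0 - e1) * (e2 - e1))) (sq e1)
    + tensor_scale (e0 * e1 / ((e0 - e2) * (e1 - e2))) (sq e2).
Proof.
rewrite /= !inE !negb_or -!andbA => /and4P[n01 n02 n12 _].
apply/ffunP => i; rewrite !ffunE.
have [] : [/\ e1 - e0 != 0, e2 - e0 != 0 & e2 - e1 != 0].
  by rewrite !subr_eq0 eq_sym n01 eq_sym n02 eq_sym n12.
have [] : [/\ e0 - e1 != 0, e0 - e2 != 0 & e1 - e2 != 0].
  by rewrite !subr_eq0 n01 n02 n12.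
move=> ? ? ? ? ? ?; field.
by do !(apply/andP; split).
Qed.

End SumOfSimple.

(** * The border rank decomposition *)

Section UpperBound.
Variables (F : fieldType) (q k : nat).

Definition Str_error : tensor F q.+1 k.+3 :=
  \sum_(i < q) simple_tensor (fun j : 'I_k.+3 =>
    basis_vec F (if (j < 3)%N then lift ord0 i else ord0)).

(** In powers of e, the q products with b_1 + e b_i contribute
    b_1 (x) (sum_i b_i) (x) b_1 at order 0, which one more simple tensor cancels,
    Str at order 1 and Str_error at order 2.  Dividing by e gives the claim. *)
Lemma Str_perturbed_rank (e : F) : e != 0 ->
  sum_of_simple (Str F q k.+3 + tensor_scale e Str_error) q.+1.
Proof.
move=> e0.
pose b := basis_vec F (d := q.+1).
pose u (i : 'I_q) (j : 'I_k.+3) :=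
  if j == 1%N :> nat then b (lift ord0 i)
  else if (j < 3)%N then b ord0 + e *: b (lift ord0 i) else b ord0.
pose v (_ : unit) (j : 'I_k.+3) :=
  if j == 1%N :> nat then \sum_(i < q) b (lift ord0 i) else b ord0.
suff -> : Str F q k.+3 + tensor_scale e Str_error
  = tensor_scale e^-1 (\sum_i simple_tensor (u i)
                       + tensor_scale (-1) (\sum_i simple_tensor (v i))).
  apply: sum_of_simpleZ.
  have := sum_of_simpleD (sum_of_simple_fin u)
            (sum_of_simpleZ (-1) (sum_of_simple_fin v)).
  by rewrite card_ord card_unit addn1.
rewrite (big_pred1 tt) => [|[]] //; rewrite /Str /Str_error /u /v.
(* Entrywise, splitting off the factors 0, 1 and 2 leaves a common product over
   the factors after the third, and the identity holds for each summand. *)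
apply/ffunP => i; rewrite !(ffunE, sum_ffunE) /=.
rewrite !big_ord_recl /= summxE mulr_suml !mulr_sumr -!big_split mulr_sumr.
apply: eq_bigr => l _.
rewrite !ffunE !big_ord_recl /= !mxE.
field.
exact: e0.
Qed.

Lemma Str_sq_rank_le (e0 e1 e2 : F) :
  uniq [:: 0; e0; e1; e2] ->
  (tensor_rank (tensor_mul (Str F q k.+3) (Str F q k.+3)) <= 3 * q.+1 ^ 2)%N.
Proof.
rewrite cons_uniq !inE !negb_or ![0 == _]eq_sym => /andP[/and3P[n0 n1 n2] Ue].
have [_] := tensor_rankP (tensor_mul (Str F q k.+3) (Str F q k.+3)) isT.
apply; rewrite (tensor_sq_interpolation _ Str_error Ue).
have -> : (3 * q.+1 ^ 2 = q.+1 * q.+1 + q.+1 * q.+1 + q.+1 * q.+1)%N by lia.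
do !apply: sum_of_simpleD; apply: (@sum_of_simpleZ _ _ (k.+2 + k.+3));
  by apply: (@sum_of_simple_mul _ _ k.+3 k.+3); apply: Str_perturbed_rank.
Qed.

End UpperBound.

(** * The lower bound by contraction *)

Lemma mxrank_sum_le (F : fieldType) (I : finType) (P : pred I) m n
    (A : I -> 'M[F]_(m, n)) :
  (forall i, \rank (A i) <= 1)%N -> (\rank (\sum_(i | P i) A i)%R <= #|P|)%N.
Proof.
move=> A1; rewrite -sum1_card.
elim/big_rec2: _ => [|i r B _ IH]; first by rewrite mxrank0.
by apply: leq_trans (mxrank_add _ _) _; apply: leq_add.
Qed.

(** An invertible square submatrix A of W selects q + 1 rows, and each column
    of the inverse of A is a functional killing q of them.  Row s of the inverse
    is nonzero, so one of these functionals is nonzero at s. *)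
Lemma functional_killing_rows (F : fieldType) r q (W : 'M[F]_(r, q.+1))
    (s : 'I_q.+1) :
  row_full W ->
  exists2 phi : 'cV[F]_q.+1,
    phi s 0 != 0 & (#|[pred a | (W *m phi) a ord0 != 0%R]| + q <= r)%N.
Proof.
move=> Wfull.
pose f := fullrankfun Wfull; pose A := rowsub f W.
have Au : A \in unitmx := fullrowsub_unit Wfull.
have [l sl] : exists l, (invmx A) s l != 0.
  apply/existsP; apply: contraT => /existsPn row0.
  have /matrixP/(_ s s) := mulVmx Au.
  rewrite !mxE eqxx big1 => [/esym/eqP|j _]; first by rewrite oner_eq0.
  by have := row0 j; rewrite negbK => /eqP ->; rewrite mul0r.
exists (col l (invmx A)); first by rewrite mxE.
have Wf j : (W *m col l (invmx A)) (f j) 0 = (j == l)%:R.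
  have /matrixP/(_ j l) := mulmxV Au; rewrite !mxE => <-.
  by apply: eq_bigr => i _; rewrite !mxE.
have finj : injective f by apply: fullrankfun_inj.
rewrite -[in leqRHS](card_ord r) -(cardC [pred a | (W *m col l (invmx A)) a 0 != 0]).
rewrite leq_add2l -[q in leqLHS]/(q.+1.-1) -[in leqLHS](card_ord q.+1) -(cardC1 l).
rewrite -(card_image finj); apply/subset_leq_card/subsetP => _ /imageP[j jl ->].
by rewrite !inE /= negbK Wf; move: jl; rewrite !inE => /negPf ->.
Qed.

Section LowerBound.
Variables (F : fieldType) (q k : nat).

(** Reading a tensor at these indices contracts every factor after the third
    with the functional dual to b_1. *)
Definition index3 (x y z : 'I_q.+1) : {ffun 'I_k.+3 -> 'I_q.+1} :=
  [ffun j : 'I_k.+3 => nth ord0 [:: x; y; z] j].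

Lemma Str_index3 x y z :
  Str F q k.+3 (index3 x y z) =
  \sum_(i < q) ((x == lift ord0 i) && (y == lift ord0 i) && (z == ord0))%:R +
  \sum_(i < q) ((x == ord0) && (y == lift ord0 i) && (z == lift ord0 i))%:R.
Proof.
rewrite /Str sum_ffunE -big_split; apply: eq_bigr => i _ /=.
rewrite !ffunE !big_ord_recl !ffunE /= !mxE /= !big1 => [|j _].
- by rewrite !mulr1 -!natrM !mulnb -!andbA.
- by rewrite ffunE mxE /= nth_nil.
Qed.

(** Contracting the third factor of Str with phi gives the matrix
    phi(b_1) sum_i b_i (x) b_i + b_1 (x) sum_i phi(b_i) b_i: its lower block is
    scalar, and its first row carries the remaining values of phi. *)
Lemma Str_contract_diag (phi : 'cV[F]_q.+1) (s t : 'I_q) :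
  \sum_z Str F q k.+3 (index3 (lift ord0 s) (lift ord0 t) z) * phi z 0
  = phi 0 0 *+ (s == t).
Proof.
rewrite (bigD1 ord0) //= big1 => [|z /negPf z0]; rewrite Str_index3.
  rewrite (bigD1 t) //= !big1 => [|i _|i /negPf it]; last first.
  - by rewrite !(inj_eq lift_inj) [t == i]eq_sym it andbF.
  - by [].
  by rewrite !(inj_eq lift_inj) !eqxx !andbT !addr0 mulr_natl.
by rewrite !big1 ?addr0 ?mul0r // => i _; rewrite ?z0 ?andbF.
Qed.

Lemma Str_contract_row (phi : 'cV[F]_q.+1) (t : 'I_q) :
  \sum_z Str F q k.+3 (index3 ord0 (lift ord0 t) z) * phi z 0
  = phi (lift ord0 t) 0.
Proof.
rewrite (bigD1 (lift ord0 t)) //= big1 => [|z /negPf zt]; rewrite Str_index3.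
  rewrite big1 // add0r (bigD1 t) //= !big1 => [|i /negPf it].
    by rewrite !eqxx !addr0 mul1r.
  by rewrite !(inj_eq lift_inj) [t == i]eq_sym it.
rewrite !big1 ?addr0 ?mul0r // => i _; rewrite -andbA.
by case: (_ =P lift ord0 i) => [/lift_inj <-|]; rewrite ?zt ?andbF.
Qed.

(** Substitution method: in a decomposition of length r, a functional on the
    third factor kills q summands while the contraction keeps rank at least q. *)
Lemma Str_rank_ge : (2 * q <= tensor_rank (Str F q k.+3))%N.
Proof.
have [[u Eu] _] := tensor_rankP (Str F q k.+3) isT.
move: (tensor_rank _) u Eu => r u Eu.
pose j0 : 'I_k.+3 := ord0.
pose j1 : 'I_k.+3 := lift ord0 ord0.
pose j2 : 'I_k.+3 := lift ord0 (lift ord0 ord0).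
(* The values at b_1 of the factors after the third are absorbed in the third
   vectors, which are the rows of W; M phi is the contraction by phi. *)
pose j3 (j : 'I_k) : 'I_k.+3 := lift ord0 (lift ord0 (lift ord0 j)).
pose c a := \prod_j u a (j3 j) 0 ord0.
pose W : 'M[F]_(r, q.+1) := \matrix_(a, z) (c a * u a j2 0 z).
pose M (phi : 'cV[F]_q.+1) : 'M[F]_q.+1 :=
  \sum_a (W *m phi) a 0 *: ((u a j0)^T *m u a j1).
have ME phi x y :
    M phi x y = \sum_z Str F q k.+3 (index3 x y z) * phi z 0.
  rewrite /M summxE Eu.
  under [RHS]eq_bigr do rewrite sum_ffunE mulr_suml.
  rewrite exchange_big /=; apply: eq_bigr => a _.
  rewrite !mxE big_ord1 mulr_suml; apply: eq_bigr => z _.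
  rewrite !ffunE !mxE !big_ord_recl !ffunE /=.
  have -> : \prod_j u a (j3 j) 0 (index3 x y z (j3 j)) = c a.
    by apply: eq_bigr => j _; rewrite ffunE /= nth_nil.
  by rewrite -/j0 -/j1 -/j2; ring.
have [-> // | q_gt0] := posnP q.
have Wfull : row_full W.
  (* The contraction M determines phi, hence so does W *m phi. *)
  rewrite /row_full -mxrank_tr -/(row_free _) -kermx_eq0; apply/rowV0P => v.
  move/sub_kermxP/(congr1 trmx); rewrite trmx_mul trmxK trmx0 => Wv.
  have M0 : M v^T = 0 by rewrite /M Wv big1 // => a _; rewrite mxE scale0r.
  apply/rowP => x; rewrite mxE -[v]trmxK mxE.
  have [t ->|->] := unliftP ord0 x.
    by rewrite -Str_contract_row -ME M0 mxE.
  have t := Ordinal q_gt0.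
  by have := Str_contract_diag v^T t t; rewrite -ME M0 mxE eqxx mulr1n.
have [phi phi0 phi_kills] := functional_killing_rows ord0 Wfull.
have rank_le : (\rank (M phi) <= #|[pred a | (W *m phi) a ord0 != 0%R]|)%N.
  rewrite /M (bigID [pred a | (W *m phi) a ord0 != 0%R]) /= addrC big1 ?add0r.
    apply: mxrank_sum_le => a; apply: leq_trans (mxrank_scale _ _) _.
    exact: leq_trans (mxrankM_maxl _ _) (rank_leq_col _).
  by move=> a; rewrite negbK => /eqP ->; rewrite scale0r.
have rank_ge : (q <= \rank (M phi))%N.
  have E : mxsub (lift ord0) (lift ord0) (M phi) = (phi ord0 0)%:M.
    by apply/matrixP => s t; rewrite mxE ME Str_contract_diag mxE.
  have rankE : \rank (mxsub (lift ord0) (lift ord0) (M phi)) = q.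
    by rewrite E -scalemx1 mxrank_scale_nz // mxrank1.
  rewrite -[leqLHS]rankE.
  rewrite -[X in mxsub _ _ X]mulmx1 mxsub_mul rowsubE.
  exact: leq_trans (mxrankM_maxl _ _) (mxrankM_maxr _ _).
lia.
Qed.

End LowerBound.

Theorem proposition17 :
  exists N : nat,
    forall (F : fieldType),
      (exists s : seq F, uniq s /\ (N <= size s)%N) ->
      forall (q k : nat), (7 <= q)%N -> (3 <= k)%N ->
        (tensor_rank (tensor_mul (Str F q k) (Str F q k))
           < tensor_rank (Str F q k) ^ 2)%N.
Proof.
(* One element may be 0; interpolation needs three others. *)
exists 4 => F [s [Us s4]] q [|[|[|k]]] // q7 _.
have [e0 [e1 [e2 Ue]]] : exists e0 e1 e2 : F, uniq [:: 0; e0; e1; e2].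
  pose s' := [seq x <- s | x != 0].
  have Us' : uniq (0 :: s') by rewrite cons_uniq mem_filter eqxx filter_uniq.
  have : (2 < size s')%N.
    rewrite size_filter; have := count_predC (pred1 0) s.
    rewrite (count_uniq_mem 0 Us) => E; move: s4; rewrite -E.
    by case: (0 \in s); [apply: id | apply: ltnW].
  case: s' Us' => [|e0 [|e1 [|e2 s']]] // Us' _.
  by exists e0, e1, e2; have := take_uniq 4 Us'; rewrite /= take0.
apply: leq_ltn_trans (Str_sq_rank_le q k Ue) _.
have : ((2 * q) ^ 2 <= tensor_rank (Str F q k.+3) ^ 2)%N.
  by rewrite leq_exp2r // Str_rank_ge.
apply: leq_trans; nia.
Qed.
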